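(* Every bad graph is equistarable.
   Context: Graphs are finite and simple. A chord of a cycle $C$ in $G$ is an edge of $G$ joining two vertices of $C$ that are non-consecutive on $C$. Given an odd cycle $C$ in $G$ and two disjoint edges $e,e'\in E(C)$, the graph $C-\{e,e'\}$ consists of two paths, exactly one of which, $P_0$, has even length; each end of $P_0$ is an endpoint of $e$ or of $e'$, and for $v\in V(P_0)$ let $d_{P_0}(v,e)$ (resp. $d_{P_0}(v,e')$) be the distance along $P_0$ from $v$ to the end of $P_0$ that is an endpoint of $e$ (resp. $e'$). An $(e,e')$-non-crossing even chord of $C$ is a chord of $C$ both of whose endpoints lie on $P_0$ and are at even distance on $P_0$. An $(e,e')$-crossing odd chord of $C$ is a chord of $C$ exactly one of whose endpoints, say $v$, lies on $P_0$, with $d_{P_0}(v,e)\equiv d_{P_0}(v,e')\equiv 1\pmod 2$. A graph $G$ of odd order $n$ is bad if it has a Hamiltonian cycle $C_n$ such that for every two disjoint edges $e,e'\in E(C_n)$, $G$ contains an $(e,e')$-non-crossing even chord of $C_n$ or an $(e,e')$-crossing odd chord of $C_n$. A star is a set $E(v)$ of all edges incident with a vertex $v$; it is maximal if not properly contained in another star. A graph $G=(V,E)$ without isolated vertices is equistarable if there is $\varphi:E\to\mathbb{R}_{>0}$ such that for every $F\subseteq E$, $F$ is a maximal star iff $\sum_{e\in F}\varphi(e)=1$. *)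

(* Defs.v *)
From mathcomp Require Import all_boot all_order all_algebra.
From mathcomp Require Import reals.

Set Implicit Arguments.
Unset Strict Implicit.
Unset Printing Implicit Defensive.

Record sgraph := SGraph {
  vertex :> finType;
  adj : rel vertex;
  adj_sym : symmetric adj;
  adj_irrefl : irreflexive adj
}.

Section Graph.
Variable G : sgraph.
Implicit Types (u v w x : G) (c p : seq G) (e f : {set G}).

Definition edges : {set {set G}} :=
  [set f | [exists u, exists v, adj u v && (f == [set u; v])]].

Definition hamiltonian_cycle c : bool :=
  [&& ucycleb (@adj G) c, 2 < size c & [forall v, v \in c]].

Definition cycle_edges c : {set {set G}} :=
  [set [set u; next c u] | u in c].

Definition chord c u v : bool :=
  [&& adj u v, u \in c, v \in c & [set u; v] \notin cycle_edges c].

(* [x :: p] is the even-length path among the two paths forming c - {e, e'},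
   listed from its end x in e to its end in e'.  Since the two components of
   c - {e, e'} are paths, each joining an endpoint of e to an endpoint of e',
   a path of c - {e, e'} between such endpoints is a whole component; hence,
   for c an odd cycle and e, e' disjoint edges of c, x and p exist and are
   unique. *)
Definition even_part c e e' x p : bool :=
  [&& path (fun u v => [set u; v] \in cycle_edges c :\: [set e; e']) x p,
      uniq (x :: p), x \in e, last x p \in e' & ~~ odd (size p)].

Definition path_dist p u v : nat := `|index u p - index v p|%N.

Definition noncrossing_even_chord c e e' u v : Prop :=
  chord c u v /\
  exists x p, [/\ even_part c e e' x p,
    u \in x :: p, v \in x :: p & ~~ odd (path_dist (x :: p) u v)].

Definition crossing_odd_chord c e e' v w : Prop :=
  chord c v w /\
  exists x p, [/\ even_part c e e' x p,
    v \in x :: p, w \notin x :: p,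
    odd (path_dist (x :: p) v x) & odd (path_dist (x :: p) v (last x p))].

Definition bad : Prop :=
  odd #|G| /\
  exists2 c, hamiltonian_cycle c &
    forall e e', e \in cycle_edges c -> e' \in cycle_edges c ->
      [disjoint e & e'] ->
      (exists u v, noncrossing_even_chord c e e' u v) \/
      (exists v w, crossing_odd_chord c e e' v w).

Definition star v : {set {set G}} := [set f in edges | v \in f].

Definition maximal_star (F : {set {set G}}) : bool :=
  maxset (fun S => S \in [set star v | v : G]) F.

Definition no_isolated_vertex : Prop := forall v, exists u, adj v u.

(* phi is only constrained, and only used, on the edges of G. *)
Definition equistarable (R : realType) : Prop :=
  no_isolated_vertex /\
  exists phi : {set G} -> R,
    (forall f, f \in edges -> 0 < phi f)%R /\
    forall F : {set {set G}}, F \subset edges ->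
      (maximal_star F <-> (\sum_(f in F) phi f = 1)%R).

End Graph.

(* Main.v *)
Require Import Defs.
From mathcomp Require Import all_boot all_order all_algebra.
From mathcomp Require Import reals.
From mathcomp Require Import boolp ring lra zify.

(** The weights giving every star the sum 1 form an affine space, and on an odd
Hamiltonian cycle the weights of the chords can be prescribed freely.  A generic
positive point of this space separates the stars from every F that does not have
sum 1 under all these weights.  If F does, then by duality there is a potential
y on the vertices with total 1 and y u + y v = [uv in F] on every edge uv.
Summing y along the cycle, F has exactly two cycle edges a, b.  If they are
adjacent, y is the indicator of their common vertex and F is its star.
Otherwise y takes the values 1, -1, ..., 1 along the even path of the cycle
minus a, b, and vanishes on the odd one; a non-crossing even chord would have
sum 2 or -2 and a crossing odd chord sum -1. *)

Set Implicit Arguments.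
Unset Strict Implicit.
Unset Printing Implicit Defensive.

Import Order.TTheory GRing.Theory Num.Theory.
Local Open Scope ring_scope.

(** * Generic points of an affine space of weights *)

(** With [S] the sum of all [|p.2 / p.1|], the choice [t = 1 / (1 + S)] makes every [t * p.2]
    smaller in absolute value than a nonzero [p.1], whose sign therefore survives. *)
Lemma small_perturbation (R : realFieldType) (s : seq (R * R)) :
  exists2 t : R, 0 < t & {in s, forall p, p.1 != 0 -> 0 < p.1 * (p.1 + t * p.2)}.
Proof.
pose S : R := \sum_(p <- s) `|p.2 / p.1|.
have S0 : 0 <= S by apply: sumr_ge0.
exists (1 + S)^-1; first by rewrite invr_gt0; lra.
move=> [a b] /= abs a0.
have le_S : `|b / a| <= S.
  by rewrite /S (big_rem (a, b)) //= lerDl sumr_ge0.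
have t1 : `|(1 + S)^-1 * (b / a)| < 1.
  rewrite normrM gtr0_norm ?invr_gt0; last lra.
  by rewrite mulrC ltr_pdivrMr; lra.
have -> : a * (a + (1 + S)^-1 * b) = a ^+ 2 * (1 + (1 + S)^-1 * (b / a)).
  by field; rewrite a0 /=; lra.
apply: mulr_gt0; first by rewrite lt0r sqr_ge0 expf_neq0.
by move: t1; rewrite ltr_norml; lra.
Qed.

(** Sets of [s] are treated one at a time: if [phi] still gives [F] the sum 1, a small move towards
    a witness [psi] for [F] changes that sum without spoiling positivity or the earlier sets. *)
Lemma generic_weights (R : realFieldType) (T : finType) (D : pred T)
    (A : (T -> R) -> Prop) (s : seq {set T}) :
  (forall phi psi t, A phi -> A psi ->
     A (fun f => phi f + t * (psi f - phi f))) ->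
  (exists2 phi, A phi & forall f, D f -> 0 < phi f) ->
  {in s, forall F : {set T}, exists2 psi, A psi & \sum_(f in F) psi f != 1} ->
  exists phi, [/\ A phi, forall f, D f -> 0 < phi f &
    {in s, forall F : {set T}, \sum_(f in F) phi f != 1}].
Proof.
move=> Aline [phi0 A0 pos0]; elim: s => [|F s IHs] Hs.
  by exists phi0; split.
case: IHs => [F' sF'|phi [Aphi pos avoid]].
  by apply: Hs; rewrite inE sF' orbT.
have [one|] := eqVneq (\sum_(f in F) phi f) 1; last first.
  by exists phi; split=> // F'; rewrite inE => /predU1P[->|/avoid].
have [|psi Apsi neq1] := Hs F; first exact: mem_head.
(* Pairs (value at [phi], slope towards [psi]) of all quantities that must stay nonzero or
   positive. *)
pose cs := [seq (phi f, psi f - phi f) | f <- enum T] ++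
  [seq (\sum_(f in F') phi f - 1, \sum_(f in F') psi f - \sum_(f in F') phi f)
     | F' : {set T} <- s].
have [t t0 Ht] := small_perturbation cs.
have sumE (F' : {set T}) : \sum_(f in F') (phi f + t * (psi f - phi f)) =
    \sum_(f in F') phi f + t * (\sum_(f in F') psi f - \sum_(f in F') phi f).
  by rewrite big_split /= -mulr_sumr sumrB.
exists (fun f => phi f + t * (psi f - phi f)); split; first exact: Aline.
- move=> f Df; have := pos f Df => pf.
  have := Ht (phi f, psi f - phi f); rewrite mem_cat map_f ?mem_enum //.
  by move=> /(_ isT) /=; rewrite pmulr_rgt0 //; apply; rewrite gt_eqF.
- move=> F'; rewrite inE sumE => /predU1P[->|sF'].
    rewrite one -subr_eq0 addrAC subrr add0r mulf_neq0 //; first by rewrite gt_eqF.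
    by rewrite subr_eq0.
  have := Ht _ _; move=> /(_ (\sum_(f in F') phi f - 1,
    \sum_(f in F') psi f - \sum_(f in F') phi f)).
  rewrite mem_cat orbC (map_f (fun F' : {set T} => (\sum_(f in F') phi f - 1,
    \sum_(f in F') psi f - \sum_(f in F') phi f))) //=.
  move=> /(_ isT); rewrite subr_eq0 => /(_ (avoid _ sF')) H.
  by apply: contraTneq H => e; rewrite addrAC e subrr mulr0 ltxx.
Qed.

(* z w is half the alternating sum of b along the orbit of w. *)
Lemma alternating_solution (R : realFieldType) (T : Type) (sigma : T -> T)
    (n : nat) (b : T -> R) :
  odd n -> (forall w, iter n sigma w = w) ->
  exists z, forall w, z w + z (sigma w) = b w.
Proof.
move=> on it.
exists (fun w => (\sum_(k < n) (-1) ^+ k * b (iter k sigma w)) / 2) => w.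
rewrite -mulrDl -big_split /=.
have -> : \sum_(k < n) ((-1) ^+ k * b (iter k sigma w) +
      (-1) ^+ k * b (iter k sigma (sigma w))) =
    \sum_(0 <= k < n) (- ((-1) ^+ k.+1 * b (iter k.+1 sigma w)) -
      - ((-1) ^+ k * b (iter k sigma w))).
  rewrite big_mkord; apply: eq_bigr => k _.
  by rewrite -iterSr exprS; ring.
(* Only the boundary terms remain; they add up to [2 * b w] because [n] is odd. *)
by rewrite telescope_sumr // it -signr_odd on /= expr0 expr1; field.
Qed.

(** * Successors, edges and stars on an odd Hamiltonian cycle *)

Section OddHamiltonianCycle.

Variables (R : realFieldType) (G : sgraph) (c : seq G).
Hypotheses (oddG : odd #|G|) (hamc : hamiltonian_cycle c).

Local Notation sigma := (next c).
Local Notation C := (cycle_edges c).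
Let edge w : {set G} := [set w; sigma w].

Let c_uniq : uniq c. Proof. by case/and3P: hamc => /andP[]. Qed.
Let in_c w : w \in c. Proof. by case/and3P: hamc => _ _ /forallP. Qed.
Let sigmaI : injective sigma. Proof. exact: can_inj (prev_next c_uniq). Qed.
Let size_c : size c = #|G|.
Proof. by rewrite -(card_uniqP c_uniq); apply: eq_card. Qed.
Let n_gt2 : (2 < #|G|)%N. Proof. by rewrite -size_c; case/and3P: hamc. Qed.

Lemma order_next w : order sigma w = #|G|.
Proof. by rewrite (order_cycle (cycle_next c_uniq)). Qed.

Lemma iter_next w : iter #|G| sigma w = w.
Proof. by rewrite -(order_next w) iter_order. Qed.

Lemma fconnect_next v w : fconnect sigma v w.
Proof. by rewrite (fconnect_cycle (cycle_next c_uniq)). Qed.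

Lemma iter_next_neq w k l : (k < #|G|)%N -> (l < #|G|)%N -> k != l ->
  iter k sigma w != iter l sigma w.
Proof.
move=> kn ln; apply: contraNneq => e.
rewrite -(@findex_iter _ sigma w k) ?order_next // e.
by rewrite findex_iter ?order_next.
Qed.

Lemma next_neq w : sigma w != w.
Proof. by apply: (@iter_next_neq w 1 0) => //; lia. Qed.

Lemma next2_neq w : sigma (sigma w) != w.
Proof. by apply: (@iter_next_neq w 2 0) => //; lia. Qed.

Lemma adj_next w : adj w (sigma w).
Proof. by case/and3P: hamc => /andP[cc _] _ _; apply: next_cycle. Qed.

Lemma edge_cycle w : edge w \in C.
Proof. by apply/imsetP; exists w. Qed.

Lemma edgesP (f : {set G}) :
  reflect (exists u v, adj u v /\ f = [set u; v]) (f \in edges G).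
Proof.
rewrite inE; apply: (iffP existsP) => [[u /existsP[v /andP[uv /eqP->]]]|].
  by exists u, v.
by case=> u [v [uv ->]]; exists u; apply/existsP; exists v; rewrite uv eqxx.
Qed.

Lemma edge_edges w : edge w \in edges G.
Proof. by apply/edgesP; exists w, (sigma w); split=> //; apply: adj_next. Qed.

(** No star contains another: if [star u] contained both cycle edges at [v] with [u != v], then [u]
    would be both successor and predecessor of [v], against [2 < #|G|]. *)
Lemma maximal_starE (F : {set {set G}}) :
  maximal_star F <-> exists v, F = star v.
Proof.
split=> [/maxsetP[/imsetP[v _ ->] _]|[v ->]]; first by exists v.
apply/maxsetP; split=> [|_ /imsetP[u _ ->] /subsetP sub]; first exact: imset_f.
have /sub : edge v \in star v by rewrite inE edge_edges set21.
rewrite inE => /andP[_ /set2P[->//|eu]].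
have ev : sigma (prev c v) = v by rewrite next_prev.
have /sub : edge (prev c v) \in star v by rewrite inE edge_edges /edge ev set22.
rewrite inE /edge ev => /andP[_ /set2P[e|->//]].
by have := next2_neq u; rewrite {1}e ev -eu eqxx.
Qed.

(** * Weights with unit stars *)

(* z w weighs the cycle edge from w to its successor, g the chords; the values of
   g on cycle edges are ignored. *)
Definition extended_weight (z : G -> R) (g : {set G} -> R) (f : {set G}) : R :=
  \sum_w z w * (edge w == f)%:R + (f \notin C)%:R * g f.

Lemma sum_extended_weight z g (S : {set {set G}}) :
  \sum_(f in S) extended_weight z g f =
  \sum_w z w * (edge w \in S)%:R + \sum_(f in S) (f \notin C)%:R * g f.
Proof.
rewrite big_split /= exchange_big; congr (_ + _); apply: eq_bigr => w _.
rewrite -mulr_sumr; congr (_ * _).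
have [wS|wS] := boolP (edge w \in S).
  by rewrite (bigD1 (edge w)) //= eqxx big1 ?addr0 // => f /andP[_];
     rewrite eq_sym => /negPf->.
rewrite big1 // => f fS; case: eqP => // e.
by move: wS; rewrite e fS.
Qed.

Definition chord_load (g : {set G} -> R) v : R :=
  \sum_(f in star v) (f \notin C)%:R * g f.

Lemma sum_star_extended_weight z g w :
  \sum_(f in star (sigma w)) extended_weight z g f =
  z w + z (sigma w) + chord_load g (sigma w).
Proof.
rewrite sum_extended_weight; congr (_ + _).
have starE u : edge u \in star (sigma w) = (u == sigma w) || (u == w).
  rewrite inE edge_edges !inE (inj_eq sigmaI) eq_sym; congr (_ || _).
  by rewrite eq_sym.
rewrite (bigD1 w) //= (bigD1 (sigma w)) ?next_neq //=.
rewrite !starE !eqxx orbT !mulr1 big1 ?addr0 // => u /andP[/negPf uw /negPf usw].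
by rewrite starE uw usw mulr0.
Qed.

Definition unit_stars (phi : {set G} -> R) : Prop :=
  forall v, \sum_(f in star v) phi f = 1.

Lemma unit_stars_extended z g :
  (forall w, z w + z (sigma w) = 1 - chord_load g (sigma w)) ->
  unit_stars (extended_weight z g).
Proof.
move=> zE v; rewrite -[v](next_prev c_uniq) sum_star_extended_weight zE.
by rewrite subrK.
Qed.

(** Weight 1/2 on cycle edges and 0 on chords is perturbed: chords get a small [t], and the cycle
    edges lose [t * z], where [z] compensates the load of chords of weight 1. *)
Lemma exists_positive_unit_stars :
  exists2 phi, unit_stars phi & forall f, f \in edges G -> 0 < phi f.
Proof.
have [z zE] := alternating_solution (fun w => chord_load (fun=> 1) (sigma w))
  oddG iter_next.
have [t t0 Ht] := small_perturbation [seq (1 / 2, - z w) | w <- enum G].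
have zpos w : 0 < 1 / 2 - t * z w.
  have := Ht (1 / 2, - z w); rewrite map_f ?mem_enum // => /(_ isT) /=.
  have half_gt0 : 0 < 1 / 2 :> R by lra.
  by move=> /(_ (lt0r_neq0 half_gt0)); rewrite pmulr_rgt0 // mulrN.
exists (extended_weight (fun w => 1 / 2 - t * z w) (fun=> t)).
  apply: unit_stars_extended => w.
  have -> : chord_load (fun=> t) (sigma w) = t * (z w + z (sigma w)).
    by rewrite zE mulr_sumr; apply: eq_bigr => f _; rewrite mulr1 mulrC.
  by field.
move=> f fE; rewrite /extended_weight.
have sum_ge0 : 0 <= \sum_w (1 / 2 - t * z w) * (edge w == f)%:R.
  by apply: sumr_ge0 => w _; rewrite mulr_ge0 ?ler0n // ltW.
have [/imsetP[w _ ->]|_] := boolP (f \in C); last by rewrite ltr_wpDl // mul1r.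
rewrite mul0r addr0 (bigD1 w) //= eqxx mulr1 ltr_pwDl // sumr_ge0 // => u _.
by rewrite mulr_ge0 ?ler0n // ltW.
Qed.

(** * Duality between edge weights and vertex potentials *)

(** The cycle edges alone determine [y]. Testing [F] against the unit-star weights that extend
    arbitrary chord weights [g] yields the rest: [g = 0] gives the total, the indicator of a chord
    gives the equation on that chord. *)
Lemma vertex_potential (F : {set {set G}}) :
  F \subset edges G ->
  (forall psi, unit_stars psi -> \sum_(f in F) psi f = 1) ->
  exists2 y : G -> R, \sum_v y v = 1 &
    forall u v, adj u v -> y u + y v = ([set u; v] \in F)%:R.
Proof.
move=> FE F1.
have [y yE] := alternating_solution (fun w => (edge w \in F)%:R : R) oddG iter_next.
have duality g : \sum_v y v * (1 - chord_load g v) +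
    \sum_(f in F) (f \notin C)%:R * g f = 1.
  have [z zE] := alternating_solution (fun w => 1 - chord_load g (sigma w))
    oddG iter_next.
  (* Summation by parts along the cycle moves the operator [1 + sigma] from [y] to [z]. *)
  rewrite -[RHS](F1 _ (unit_stars_extended zE)) sum_extended_weight; congr (_ + _).
  under [RHS]eq_bigr => w _ do rewrite -yE mulrDr.
  rewrite big_split [LHS](reindex_inj sigmaI) [X in _ = X + _](reindex_inj sigmaI).
  rewrite -[RHS]big_split; apply: eq_bigr => w _ /=.
  by rewrite -zE; ring.
have sum_y : \sum_v y v = 1.
  rewrite -[RHS](duality (fun=> 0)) [X in _ = _ + X]big1 ?addr0 => [|f _]; last first.
    by rewrite mulr0.
  apply: eq_bigr => v _; rewrite /chord_load big1 ?subr0 ?mulr1 // => f _.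
  by rewrite mulr0.
exists y => // u v uv.
have [/imsetP[w _ e]|uvC] := boolP ([set u; v] \in C).
  rewrite e -[RHS]yE.
  have uw : u \in edge w by rewrite /edge -e set21.
  have vw : v \in edge w by rewrite /edge -e set22.
  have uNv : u != v by apply: contraTneq uv => ->; rewrite adj_irrefl.
  case/set2P: uw uNv => ->; case/set2P: vw => ->; rewrite ?eqxx // => _.
  exact: addrC.
have uvE : [set u; v] \in edges G by apply/edgesP; exists u, v.
pose g f : R := (f == [set u; v])%:R.
have sum_g (S : {set {set G}}) :
    \sum_(f in S) (f \notin C)%:R * g f = ([set u; v] \in S)%:R.
  have [uvS|uvS] := boolP ([set u; v] \in S).
    rewrite (bigD1 [set u; v]) //= /g eqxx uvC mulr1 big1 ?addr0 // => f.
    by case/andP=> _ /negPf->; rewrite mulr0.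
  rewrite big1 // => f fS; rewrite /g; case: eqP => [e|]; last by rewrite mulr0.
  by move: uvS; rewrite -e fS.
have := duality g; rewrite sum_g => load_uv.
suff : \sum_w y w * (1 - chord_load g w) = 1 - (y u + y v).
  by move=> H; move: load_uv; rewrite H; lra.
rewrite -[X in _ = X - _]sum_y.
under eq_bigr => w _ do rewrite mulrBr mulr1.
rewrite sumrB; congr (_ - _).
have loadE w : chord_load g w = (w \in [set u; v])%:R.
  by rewrite /chord_load sum_g inE uvE.
under eq_bigr => w _ do rewrite loadE.
have vu : v != u by apply: contraTneq uv => ->; rewrite adj_irrefl.
rewrite (bigD1 u) //= (bigD1 v) //= set21 set22 !mulr1 big1 ?addr0 // => w.
by case/andP=> /negPf wu /negPf wv; rewrite !inE wu wv mulr0.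
Qed.


(** * Paths of the cycle minus two edges *)

Lemma cycle_step a b u v :
  [set u; v] \in C :\: [set edge a; edge b] ->
  v = sigma u /\ u \notin [set a; b] \/ u = sigma v /\ v \notin [set a; b].
Proof.
case/setDP=> /imsetP[w _ e] nab.
have nw : w \notin [set a; b].
  by apply: contra nab => /set2P[]<-; rewrite e ?set21 ?set22.
have [wu su] : w \in [set u; v] /\ sigma w \in [set u; v].
  by rewrite e set21 set22.
have := next_neq w; case/set2P: wu => ew; case/set2P: su => es.
- by rewrite es ew eqxx.
- by left; rewrite -ew es.
- by right; rewrite -ew es.
- by rewrite es ew eqxx.
Qed.

(** A discrete intermediate value theorem: [idx] climbs by at most one per step, so it skips no
    value. *)
Lemma path_hits (T : eqType) (idx : T -> nat) k x p :
  path (fun u v => idx v <= (idx u).+1)%N x p ->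
  (idx x <= k <= idx (last x p))%N -> exists2 w, w \in x :: p & idx w = k.
Proof.
elim: p x => [|z p IHp] x /=.
  by move=> _ /anti_leq e; exists x; rewrite ?mem_head.
case/andP=> xz zp /andP[xk kl].
have [e|/eqP ne] := eqVneq (idx x) k; first by exists x; rewrite ?mem_head.
have [|w wp e] := IHp z zp; first by rewrite kl andbT; lia.
by exists w => //; rewrite inE wp orbT.
Qed.

Lemma path_alternates (T : eqType) (y : T -> R) x p :
  path (fun u v => y v == - y u) x p ->
  {in x :: p, forall u, y u = (-1) ^+ index u (x :: p) * y x}.
Proof.
elim: p x => [|z p IHp] x /=.
  by move=> _ u /[!inE] /eqP->; rewrite eqxx mul1r.
case/andP=> /eqP yz zp u; rewrite inE eq_sym.
case: eqVneq => [<- _|_ /= /(IHp z zp) ->]; first by rewrite mul1r.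
by rewrite /= exprS yz mulrN mulN1r mulNr.
Qed.

(* a and b stand for the cycle edges from a and b to their successors; m is the
   length of the arc from the successor of a to b. *)
Section EvenArc.

Variables (a b : G) (y : G -> R).
(** Positions start at [sigma a], so [a] comes last and [sigma] raises the position by one
    everywhere else. *)
Let idx w := findex sigma (sigma a) w.
Let m := idx b.
Hypotheses (ab : a != b) (m_even : ~~ odd m).
Hypothesis yE : forall w, y w + y (sigma w) = (w \in [set a; b])%:R.

Let idx_lt w : (idx w < #|G|)%N.
Proof. by rewrite -(order_next (sigma a)) findex_max ?fconnect_next. Qed.

Let idxK w : iter (idx w) sigma (sigma a) = w.
Proof. by rewrite iter_findex ?fconnect_next. Qed.

Let iterK k : (k < #|G|)%N -> idx (iter k sigma (sigma a)) = k.
Proof. by move=> kn; rewrite /idx findex_iter ?order_next. Qed.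

Let idx_inj : injective idx.
Proof. by move=> u v e; rewrite -(idxK u) e idxK. Qed.

Let idx_a : idx a = #|G|.-1.
Proof.
rewrite -[X in idx X](iter_next a) -{1}(@prednK #|G|) ?iterSr ?iterK; lia.
Qed.

Let idx_next w : w != a -> idx (sigma w) = (idx w).+1.
Proof.
move=> wa; rewrite -{1}(idxK w) -iterS iterK //.
have : idx w != idx a by rewrite (inj_eq idx_inj).
by have := idx_lt w; rewrite idx_a; lia.
Qed.

(** Position [#|G| - 1] belongs to [a], and [#|G| - 2] is odd while [m] is even. *)
Lemma even_arc_lt : (m.+2 < #|G|)%N.
Proof.
have : m != idx a by rewrite (inj_eq idx_inj) eq_sym.
by have := idx_lt b; rewrite -/m idx_a; lia.
Qed.

Let y_next w : w != a -> w != b -> y (sigma w) = - y w.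
Proof.
move=> /negPf wa /negPf wb; have := yE w; rewrite !inE wa wb /=; lra.
Qed.

(** The two bounds keep the walk from crossing [edge a] or [edge b]. *)
Let y_iter k j : (k + j < #|G|)%N -> (m < k \/ k + j <= m)%N ->
  y (iter (k + j) sigma (sigma a)) = (-1) ^+ j * y (iter k sigma (sigma a)).
Proof.
elim: j => [|j IHj] kjn km; first by rewrite addn0 expr0 mul1r.
rewrite addnS iterS y_next; first (rewrite IHj; [by rewrite exprS mulN1r mulNr | lia | lia]).
- by apply/eqP => /(congr1 idx); rewrite iterK ?idx_a; lia.
- by apply/eqP => /(congr1 idx); rewrite iterK -/m; lia.
Qed.

(** Put [s = y (sigma a)]. The even arc gives [y b = s], so [y (sigma b) = 1 - s]; the other arc has
    odd length, so [y a = s - 1]. The equation on [edge a] then forces [s = 1], and [y] vanishes on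
    the other arc. *)
Lemma potential_on_arc w :
  y w = if (idx w <= m)%N then (-1) ^+ idx w else 0.
Proof.
have mn := even_arc_lt.
have y0 k : (k <= m)%N -> y (iter k sigma (sigma a)) = (-1) ^+ k * y (sigma a).
  by move=> km; apply: (@y_iter 0 k); lia.
have yb : y b = y (sigma a).
  by rewrite -[b]idxK y0 // -signr_odd (negPf m_even) mul1r.
have ysb : y (iter m.+1 sigma (sigma a)) = 1 - y (sigma a).
  by rewrite iterS idxK; have := yE b; rewrite set22 yb /=; lra.
have ya : y a = - (1 - y (sigma a)).
  rewrite -{1}[a]idxK idx_a -ysb.
  have -> : (#|G|.-1 = m.+1 + (#|G|.-2 - m))%N by lia.
  have odd_rest : odd (#|G|.-2 - m) by lia.
  rewrite y_iter; [|lia|by left].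
  by rewrite -signr_odd odd_rest mulN1r.
have y1 : y (sigma a) = 1 by have := yE a; rewrite set21 ya /=; lra.
case: leqP => [km|mk]; first by rewrite -{1}[w]idxK y0 // y1 mulr1.
rewrite -[w]idxK -(subnKC mk) y_iter ?ysb ?y1 ?subrr ?mulr0 //; last by left.
by rewrite subnKC ?idx_lt.
Qed.

Let y_eq1 w : y w = 1 -> (idx w <= m)%N.
Proof.
by rewrite potential_on_arc; case: ifP => // _ /eqP; rewrite eq_sym oner_eq0.
Qed.

(** The path is shown to run from [sigma a] to [b], hence through all positions up to [m], which
    include every vertex of potential 1. *)
Lemma even_part_potential x p :
  even_part c (edge a) (edge b) x p ->
  {in x :: p, forall u, y u = (-1) ^+ index u (x :: p)} /\
  (forall w, y w = 1 -> w \in x :: p).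
Proof.
case/and5P=> xp xp_uniq xa lb p_even.
have idx_sa : idx (sigma a) = 0%N by rewrite /idx findex0.
have idx_sb : idx (sigma b) = m.+1 by rewrite idx_next // eq_sym.
have step u v : [set u; v] \in C :\: [set edge a; edge b] ->
    y v = - y u /\ (idx v = (idx u).+1 \/ idx u = (idx v).+1).
  case/cycle_step=> [] [-> /[!inE] /norP[na nb]]; rewrite y_next // idx_next //.
    by split; [|left].
  by rewrite opprK; split; [|right].
have alt : {in x :: p, forall u, y u = (-1) ^+ index u (x :: p) * y x}.
  by apply: path_alternates; apply: sub_path xp => u v /step[->].
have alt_last := alt _ (mem_last x p).
(* Each step flips the parity of [idx], the length is even, and both ends of [edge a] have even
   position, 0 or [#|G| - 1]. This excludes [sigma b], at the odd position [m + 1]. *)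
have even_idx_last : ~~ odd (idx (last x p)).
  have : (-1) ^+ idx (last x p) =
      (-1) ^+ index (last x p) (x :: p) * (-1) ^+ idx x :> R.
    apply: (path_alternates (y := fun w => (-1) ^+ idx w)) (mem_last x p).
    apply: sub_path xp => u v /step[_ [] ->]; rewrite exprS mulN1r ?opprK //.
  rewrite index_last // -signr_odd -(signr_odd _ (size p)) (negPf p_even).
  have -> : (-1) ^+ idx x = 1 :> R.
    rewrite -signr_odd; case/set2P: xa => ->; rewrite ?idx_sa // idx_a.
    have -> // : odd #|G|.-1 = false by lia.
  by case: odd => //=; lra.
have last_b : last x p = b.
  by case/set2P: lb => // lsb; move: even_idx_last; rewrite lsb idx_sb /= m_even.
have yb : y b = 1 by rewrite potential_on_arc leqnn -signr_odd (negPf m_even).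
have yx : y x = 1.
  move: alt_last; rewrite last_b yb -[b in index b _]last_b index_last //.
  by rewrite -signr_odd (negPf p_even) mul1r.
have x_sa : x = sigma a.
  case/set2P: xa => // x_a; have := y_eq1 yx.
  by have := even_arc_lt; rewrite x_a idx_a; lia.
split=> [u /alt ->|w /y_eq1 wm]; first by rewrite yx mulr1.
have [||w' w'p /idx_inj <- //] := @path_hits _ idx (idx w) x p.
  by apply: sub_path xp => u v /step[_ [] ->]; lia.
by rewrite last_b x_sa idx_sa.
Qed.

(** Vertices at even distance have equal potentials, with sum 2 or -2. In the crossing case
    [y u = -1] and [y v < 1], so the sum is negative. *)
Lemma even_part_chordless u v :
  adj u v -> (y u + y v = 0 \/ y u + y v = 1) ->
  ~ noncrossing_even_chord c (edge a) (edge b) u v /\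
  ~ crossing_odd_chord c (edge a) (edge b) u v.
Proof.
move=> uv yuv; split=> -[_ [x [p []]]] /even_part_potential[alt cover].
  move=> /alt yu /alt yv; rewrite /path_dist => even_uv; move: yuv.
  rewrite yu yv -signr_odd -[(-1) ^+ index v _]signr_odd.
  have -> : odd (index u (x :: p)) = odd (index v (x :: p)) by lia.
  by case: odd => /=; lra.
move=> /alt yu vp; rewrite /path_dist index_head => odd_u _.
have y1 : y v != 1 by apply: contra vp => /eqP /cover.
move: yuv; rewrite yu -signr_odd.
have -> /= : odd (index u (x :: p)) = true by lia.
have : 0 <= 1 - y v.
  rewrite (potential_on_arc v); case: ifP => _; last lra.
  by rewrite -signr_odd; case: odd => /=; lra.
by move: y1; rewrite neq_lt => /orP[]; lra.
Qed.

End EvenArc.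

(** * From potentials to stars *)

(** The lengths of the two arcs add up to the odd number [#|G| - 2]. *)
Lemma arc_parity a b : a != b ->
  ~~ odd (findex sigma (sigma a) b) \/ ~~ odd (findex sigma (sigma b) a).
Proof.
move=> ab; set m := findex _ _ _.
have mn : (m < #|G|)%N by rewrite -(order_next (sigma a)) findex_max ?fconnect_next.
have bE : iter m sigma (sigma a) = b by rewrite iter_findex ?fconnect_next.
have m_neq : m != #|G|.-1.
  apply: contra ab => /eqP mE; rewrite -bE mE -iterSr prednK ?iter_next //; lia.
have [odd_m|] := boolP (odd m); last by left.
have aE : iter (#|G|.-2 - m) sigma (sigma b) = a.
  rewrite -bE -iterS -iterD -iterSr.
  have -> : ((#|G|.-2 - m + m.+1).+1 = #|G|)%N by lia.
  exact: iter_next.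
by right; rewrite -aE findex_iter ?order_next; lia.
Qed.

Hypothesis chords : forall e e', e \in C -> e' \in C -> [disjoint e & e'] ->
  (exists u v, noncrossing_even_chord c e e' u v) \/
  (exists v w, crossing_odd_chord c e e' v w).

Lemma star_of_indicator (F : {set {set G}}) (y : G -> R) v :
  F \subset edges G -> (forall w, y w = (w == v)%:R) ->
  (forall u w, adj u w -> y u + y w = ([set u; w] \in F)%:R) -> F = star v.
Proof.
move=> FE yv yF; apply/setP=> f; rewrite inE.
have [|fE] := boolP (f \in edges G); last first.
  by apply/negbTE; apply: contra fE; apply/subsetP.
case/edgesP=> u [w [uw ->]]; have := yF u w uw; rewrite !yv !inE.
rewrite ![v == _]eq_sym.
have : ~~ ((u == v) && (w == v)).
  by apply: contraTN uw => /andP[/eqP-> /eqP->]; rewrite adj_irrefl.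
by case: (u == v); case: (w == v); case: (_ \in F) => //= _; lra.
Qed.

Lemma star_of_potential (F : {set {set G}}) (y : G -> R) :
  F \subset edges G -> \sum_v y v = 1 ->
  (forall u v, adj u v -> y u + y v = ([set u; v] \in F)%:R) ->
  exists v, F = star v.
Proof.
move=> FE sum_y yF.
(* Each vertex lies on two cycle edges, so the equations on the cycle sum to twice the total of
   [y]. *)
have : #|[set w | edge w \in F]| == 2.
  rewrite -(eqr_nat R) -sum1_card natr_sum.
  have -> : \sum_(w in [set w | edge w \in F]) 1 = \sum_w (y w + y (sigma w)) :> R.
    rewrite big_mkcond; apply: eq_bigr => w _.
    by rewrite inE yF ?adj_next //; case: ifP.
  by rewrite big_split -(reindex_inj (P := xpredT) (F := y) sigmaI) /= sum_y.
case/cards2P=> a [b [ab abF]].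
wlog even_m : a b ab abF / ~~ odd (findex sigma (sigma a) b).
  move=> wlog_ab; case: (arc_parity ab) => [|m_even]; first exact: wlog_ab.
  by apply: (wlog_ab b a); rewrite // 1?eq_sym // abF setUC.
have yE w : y w + y (sigma w) = (w \in [set a; b])%:R.
  by rewrite yF ?adj_next // -abF inE.
(* Here the even arc is the single vertex [sigma a]. *)
have [m0|m0] := eqVneq b (sigma a).
  exists (sigma a); apply: star_of_indicator yF => // w.
  rewrite (potential_on_arc ab even_m yE) m0 findex0 leqn0.
  have [->|wsa] := eqVneq w (sigma a); first by rewrite findex0.
  case: eqP => // w0; case/eqP: wsa.
  by rewrite -[w](@iter_findex _ sigma (sigma a)) ?fconnect_next // w0.
(* Adjacency on this side would close the cycle after [m + 2] steps, too early. *)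
have [sb_a|sb_a] := eqVneq (sigma b) a.
  have := even_arc_lt ab even_m; set m := findex _ _ _ => mn.
  have : iter m.+2 sigma a != iter 0 sigma a by apply: iter_next_neq; lia.
  by rewrite iterS iterSr iter_findex ?fconnect_next //= sb_a eqxx.
have disj : [disjoint edge a & edge b].
  rewrite disjoint_subset; apply/subsetP=> w /set2P[]->; rewrite !inE negb_or.
    by rewrite ab eq_sym.
  by rewrite eq_sym m0 (inj_eq sigmaI).
have yuv u v : adj u v -> y u + y v = 0 \/ y u + y v = 1.
  by move=> /yF->; case: (_ \in F); [right|left].
by case: (chords (edge_cycle a) (edge_cycle b) disj) => -[u [v uv]];
  have [uv_adj _ _ _] := and4P (proj1 uv);
  case: (even_part_chordless ab even_m yE uv_adj (yuv _ _ uv_adj)).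
Qed.

End OddHamiltonianCycle.

Theorem theorem7 (R : realType) (G : sgraph) : bad G -> equistarable G R.
Proof.
case=> oddG [c hamc chords]; split.
  by move=> v; exists (next c v); apply: adj_next.
(* The finitely many edge sets whose sum must avoid 1. *)
pose s := [seq F <- enum (powerset (edges G)) |
  F \notin [set star v | v in G]].
have [|||phi [stars pos avoid]] := @generic_weights R _ (fun f => f \in edges G)
  (@unit_stars R G) s.
- move=> phi psi t phi1 psi1 v.
  by rewrite big_split /= -mulr_sumr sumrB phi1 psi1 subrr mulr0 addr0.
- exact: (exists_positive_unit_stars R oddG hamc).
- move=> F; rewrite mem_filter mem_enum powersetE => /andP[/imsetP nF FE].
  (* If all unit-star weights gave [F] the sum 1, its potential would make it a star. *)
  apply: contrapT => no_psi; case: nF.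
  have [|y sum_y yF] := @vertex_potential R G c oddG hamc F FE.
    move=> psi psi1; apply: contrapT => psi_neq; case: no_psi.
    by exists psi => //; apply/eqP.
  by have [v ->] := star_of_potential oddG hamc chords FE sum_y yF; exists v.
exists phi; split=> // F FE; rewrite (maximal_starE oddG hamc); split.
  by case=> v ->.
move=> phiF; have [/imsetP[v _ ->]|nF] := boolP (F \in [set star v | v in G]).
  by exists v.
have := avoid F; rewrite mem_filter mem_enum powersetE nF FE => /(_ isT).
by rewrite phiF eqxx.
Qed.
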